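(* Let $K$ be a fixed, sufficiently large positive integer. For every $\delta>0$ there is $N_0(\delta)$ such that the following holds for every natural number $N\geq N_0(\delta)$. Put $y=(\log N)^K$, let $\mathcal{S}(N,y)$ be the set of positive integers $n\leq N$ all of whose prime factors are at most $y$, and let $\Psi(N,y)=|\mathcal{S}(N,y)|$. If $A\subseteq \mathcal{S}(N,y)$ satisfies $|A|\geq \delta\,\Psi(N,y)$, then $A$ contains a nontrivial arithmetic progression of length $3$, i.e. there are integers $n$ and $d\neq 0$ with $n,\ n+d,\ n+2d\in A$.
   Context: A positive integer is $y$-smooth if every prime factor of it is at most $y$. *)

(* Defs.v *)
From HB Require Import structures.
From mathcomp Require Import all_boot all_order all_algebra.
From mathcomp Require Import finmap.
From mathcomp Require Import reals exp.
Set Implicit Arguments.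
Unset Strict Implicit.
Unset Printing Implicit Defensive.
Import Order.TTheory GRing.Theory Num.Theory.
Local Open Scope ring_scope.

(* The bound y is real, as it is instantiated with a power of a logarithm. *)
Definition smooth (R : realType) (y : R) (n : nat) : bool :=
  (0 < n)%N && all (fun p : nat => p%:R <= y) (primes n).

Definition smooth_set (R : realType) (N : nat) (y : R) : {fset nat} :=
  [fset n in iota 1 N | smooth y n]%fset.

Definition Psi (R : realType) (N : nat) (y : R) : nat := #|` smooth_set N y|%fset.

(* The common difference ranges over int and may be negative, so A is embedded
   in int before testing membership. *)
Definition has_3AP (A : {fset nat}) : Prop :=
  let AZ : {fset int} := [fset Posz a | a in A]%fset in
  exists n d : int, [/\ d != 0, n \in AZ, n + d \in AZ & n + 2 * d \in AZ].

(* Main.v *)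
Require Import Defs.
From HB Require Import structures.
From mathcomp Require Import all_boot all_order all_algebra.
From mathcomp Require Import finmap.
From mathcomp Require Import zify ring lra.
From mathcomp Require Import boolp reals sequences exp.
Import Order.TTheory GRing.Theory Num.Theory.
Set Implicit Arguments.
Unset Strict Implicit.
Unset Printing Implicit Defensive.

(* Let T_n(x) be the number of divisors of n that are at most x, and let
   D_n(P) = T_n(2P) - T_n(P). Suppose that A, a set of y-smooth numbers up to N,
   has no progression of length 3. For every m the set of f in (P, 2P] with m f
   in A has no progression either, so by Roth's theorem it has at most eta P
   elements once P is large. Counting the factorisations n = m f of the n in A
   with weight 1 / T_n(P) <= 1 / T_m(P) gives
     sum_(n in A) D_n(P) / T_n(P) <= eta sum_m P / T_m(P),
   over smooth m <= N / P. The right-hand side is O(eta Psi(N, y)): a second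
   count of factorisations n = m f, now over all smooth n and with f in
   (P/2, P], weighted by 1 / D_n(P/2), reduces this to the bound
   sum_(f in (P/2, P]) D_(mf)(P/2) = O(P T_m(P)).

   Now sum over P = 2^j up to y. Since D_n(P) / T_n(P) >= ln (T_n(2P) / T_n(P)),
   the left-hand side telescopes to at least ln (T_n(y) / P_0) for each n in A.
   All but a negligible part of the smooth n have at least y^c prime factors, so
   this is of order ln y, the number of scales. Hence eta is bounded below by a
   multiple of delta, which is absurd for a small eta. No information on the
   local distribution of smooth numbers is needed. *)

(** * Roth's theorem *)

Definition ap3_free (B : pred nat) : Prop :=
  forall a d, 0 < d -> B a -> B (a + d) -> B (a + d + d) -> False.

Definition cnt (P : pred nat) (a b : nat) : nat := \sum_(a <= v < b) (P v : nat).

Lemma cnt_cat (P : pred nat) a b c : a <= b -> b <= c -> cnt P a c = cnt P a b + cnt P b c.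
Proof. by move=> ab bc; rewrite /cnt (big_cat_nat ab bc). Qed.

Lemma cnt_le (P : pred nat) a b : cnt P a b <= b - a.
Proof.
rewrite /cnt; apply: leq_trans (_ : \sum_(a <= v < b) 1 <= _).
  by apply: leq_sum => i _; case: (P i).
by rewrite sum_nat_const_nat muln1.
Qed.

Lemma cnt_sub (P Q : pred nat) a b :
  (forall v, a <= v < b -> P v -> Q v) -> cnt P a b <= cnt Q a b.
Proof.
move=> PQ; rewrite /cnt big_nat_cond [leqRHS]big_nat_cond.
apply: leq_sum => i; rewrite andbT => /PQ; case: (P i) => // /(_ isT) ->//.
Qed.

Lemma cnt_shift (P : pred nat) d a b : cnt P (a + d) (b + d) = cnt (fun v => P (v + d)) a b.
Proof. by rewrite /cnt big_addn addnK. Qed.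

Lemma cnt_filter (P : pred nat) a b : cnt P a b = size [seq v <- index_iota a b | P v].
Proof.
rewrite /cnt size_filter -sum1_count [RHS]big_mkcond.
by apply: eq_bigr => v _; case: (P v).
Qed.

Lemma ap3_free_sub (B C : pred nat) : (forall v, C v -> B v) -> ap3_free B -> ap3_free C.
Proof. by move=> CB fB a d d0 /CB Ba /CB Bb /CB Bc; apply: (fB a d). Qed.

Lemma ap3_free_affine (B : pred nat) a d : 0 < d -> ap3_free B ->
  ap3_free (fun i => B (a + i * d)).
Proof.
move=> d0 fB x e e0 B1 B2 B3; apply: (fB (a + x * d) (e * d)) => //.
- by rewrite muln_gt0 e0.
- by rewrite -addnA -mulnDl.
- by rewrite -!addnA -!mulnDl addnA.
Qed.

(** The sliding windows below read [B] backwards. The guard [i * d <= a] stops truncated subtraction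
    from repeating the value at 0. *)
Lemma ap3_free_reflect (B : pred nat) a d : 0 < d -> ap3_free B ->
  ap3_free (fun i => (i * d <= a) && B (a - i * d)).
Proof.
move=> d0 fB x e e0 /andP[_ B1] /andP[_ B2] /andP[h B3].
apply: (fB (a - (x + e + e) * d) (e * d)) => //.
- by rewrite muln_gt0 e0.
- by have -> : a - (x + e + e) * d + e * d = a - (x + e) * d by nia.
- by have -> : a - (x + e + e) * d + e * d + e * d = a - x * d by nia.
Qed.

(** * Hilbert cubes in dense sets *)

Fixpoint hcube (x : nat) (ds : seq nat) : seq nat :=
  if ds is d :: ds' then hcube x ds' ++ [seq m + d | m <- hcube x ds'] else [:: x].

Lemma separated_cnt (P : pred nat) D a w : 0 < D ->
  (forall v e, P v -> 0 < e <= D -> ~~ P (v + e)) ->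
  D * cnt P a (a + w) <= w + D.
Proof.
move=> D0 sep; elim/ltn_ind: w a => w IH a.
case: (posnP w) => [->|w0]; first by rewrite /cnt addn0 big_geq //; lia.
have [Pa|nPa] := boolP (P a).
  have [wD|Dw] := leqP w D.
    rewrite (@cnt_cat P a a.+1) ?leq_addr //; last by lia.
    have -> : cnt P a.+1 (a + w) = 0.
      apply/eqP; rewrite /cnt sum_nat_seq_eq0; apply/allP => i.
      rewrite mem_index_iota => hi /=; rewrite eqb0.
      by rewrite -(subnKC (_ : a <= i)) ?sep //; lia.
    have := cnt_le P a a.+1; nia.
  rewrite (@cnt_cat P a (a + D)) ?leq_add2l //; try lia.
  have -> : a + w = a + D + (w - D) by lia.
  have := IH (w - D) ltac:(lia) (a + D).
  rewrite (@cnt_cat P a a.+1) //; last by lia.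
  have -> : cnt P a.+1 (a + D) = 0.
    apply/eqP; rewrite /cnt sum_nat_seq_eq0; apply/allP => i.
    rewrite mem_index_iota => hi /=; rewrite eqb0.
    by rewrite -(subnKC (_ : a <= i)) ?sep //; lia.
  have := cnt_le P a a.+1; nia.
rewrite (@cnt_cat P a a.+1) //; last by lia.
have := IH w.-1 ltac:(lia) a.+1.
have -> : a.+1 + w.-1 = a + w by lia.
have -> : cnt P a a.+1 = 0 by rewrite /cnt big_nat1 (negbTE nPa).
lia.
Qed.

(** At most [w / (2 * t) + 1] points of [B] have no further point of [B] within distance [2 * t]. At
    least [w / (4 * t)] points remain, and one of the [2 * t] gaps serves [w / (8 * t ^ 2)] of
    them. *)
Lemma hcube_step (t : nat) (B : pred nat) a w : 0 < t -> 4 * t <= w ->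
  w <= t * cnt B a (a + w) ->
  exists2 d, 0 < d <= 2 * t &
    w <= 8 * t ^ 2 * cnt (fun v => B v && B (v + d)) a (a + w).
Proof.
move=> t0 tw dB.
pose E v := [exists d : 'I_(2 * t), B (v + d.+1)].
pose P v := B v && ~~ E v.
have hP : 2 * t * cnt P a (a + w) <= w + 2 * t.
  apply: separated_cnt => [|v e /andP[_ nE] he]; first by lia.
  apply/negP => /andP[Bve _]; move/existsP: nE; apply.
  have h : e.-1 < 2 * t by lia.
  by exists (Ordinal h) => /=; rewrite prednK //; lia.
pose f d v := B v && B (v + d.+1).
have hsum : cnt B a (a + w) <= cnt P a (a + w) + \sum_(d < 2 * t) cnt (f d) a (a + w).
  rewrite /cnt exchange_big -big_split /=; apply: leq_sum => v _.
  case Bv: (B v) => //=; rewrite /P Bv /=.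
  case: (boolP (E v)) => [/existsP[d Bd]|_] //=.
  by rewrite (bigD1 d) //= /f Bv Bd.
have [/existsP[d hd]|/existsPn nd] :=
  boolP [exists d : 'I_(2 * t), w <= 8 * t ^ 2 * cnt (f d) a (a + w)].
  by exists d.+1 => //; case: d {hd} => d /=; lia.
exfalso.
have : \sum_(d < 2 * t) (8 * t ^ 2 * cnt (f d) a (a + w)) <= \sum_(d < 2 * t) w.-1.
  by apply: leq_sum => d _; move: (nd d); rewrite -ltnNge; lia.
rewrite sum_nat_const card_ord -big_distrr /=.
move: hsum hP; set s := \sum_(d < _) _; set c := cnt P _ _; set b := cnt B _ _ in dB *.
rewrite -!mulnn => h1 h2 h3.
have h4 : 4 * t * s <= w.-1 by nia.
have : 4 * (t * b) <= 4 * (t * (c + s)) by rewrite !leq_mul2l /= h1 orbT.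
nia.
Qed.

(** Each use of [hcube_step] yields one generator and lowers the density from [1 / t] to
    [1 / (8 * t ^ 2)]. What matters is that [D] and [w0] are fixed before the set and the window. *)
Lemma hcube_exists (n t : nat) : 0 < t -> exists D w0, forall w a (B : pred nat),
  w0 <= w -> w <= t * cnt B a (a + w) ->
  exists x ds, [/\ size ds = n, all (fun d => 0 < d <= D) ds
     & {in hcube x ds, forall v, (a <= v < a + w) && B v}].
Proof.
elim: n t => [|n IH] t t0.
  exists 0, 1 => w a B w1 hw.
  case: (boolP (has B (index_iota a (a + w)))) => [/hasP[x]|/hasPn nB].
    rewrite mem_index_iota => hx Bx.
    by exists x, [::]; split=> // v; rewrite inE => /eqP ->; rewrite hx.
  have : cnt B a (a + w) = 0; last by lia.
  apply/eqP; rewrite /cnt sum_nat_seq_eq0; apply/allP => i hi /=.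
  by rewrite eqb0 nB.
have [D [w0 hD]] := IH (8 * t ^ 2) ltac:(by rewrite muln_gt0 expn_gt0 t0).
exists (maxn D (2 * t)), (maxn w0 (4 * t)) => w a B hw dB.
(* Restricting to the window keeps both ends of each gap, hence the whole cube, inside it. *)
pose B' v := (a <= v < a + w) && B v.
have cB' : cnt B a (a + w) = cnt B' a (a + w).
  by apply/eqP; rewrite eqn_leq /B'; apply/andP; split; apply: cnt_sub => v ->.
have [|d d0 /hD[|x [ds [sds ads cds]]]] := @hcube_step t B' a w t0 ltac:(lia).
- by rewrite -cB'.
- by lia.
exists x, (d :: ds); split => [|/=|v /=].
- by rewrite /= sds.
- apply/andP; split; first by lia.
  by apply: sub_all ads => e; lia.
- rewrite mem_cat => /orP[/cds /andP[h /andP[]]|/mapP[u /cds /andP[_ /andP[_]]]] //.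
  by move=> Bu ->.
Qed.

(** * Translates and sliding windows *)

Definition shiftp (P : pred nat) (e v : nat) : bool := (e <= v) && P (v - e).

Lemma shiftpD (P : pred nat) d e v : shiftp P (d + e) v = shiftp (shiftp P d) e v.
Proof.
rewrite /shiftp; case: (leqP e v) => ev /=.
  by rewrite subnDAC [d + e]addnC leq_subRL // subnDA.
by case: leqP => //; lia.
Qed.

Lemma cnt_shiftp (P : pred nat) n e V : (forall v, P v -> v < n) -> n + e <= V ->
  cnt (shiftp P e) 0 V = cnt P 0 n.
Proof.
move=> Pn nV; rewrite (@cnt_cat _ 0 e) //; last by lia.
have -> : cnt (shiftp P e) 0 e = 0.
  rewrite /cnt big_nat_cond big1 // => v; rewrite andbT /shiftp => h.
  by case: leqP => //; lia.
rewrite add0n -[X in cnt _ X _](add0n e) -[V](@subnK e); last by lia.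
rewrite cnt_shift (@cnt_cat _ 0 n) //; last by lia.
rewrite [X in _ + X](_ : _ = 0) ?addn0.
  by apply: eq_bigr => v _; rewrite /shiftp leq_addl addnK.
rewrite /cnt big_nat_cond big1 // => v; rewrite andbT /shiftp leq_addl addnK /= => h.
by case: (boolP (P v)) => // /Pn; lia.
Qed.

Lemma cnt_split (P Q : pred nat) a b :
  cnt P a b = cnt (fun v => P v && Q v) a b + cnt (fun v => P v && ~~ Q v) a b.
Proof.
by rewrite /cnt -big_split; apply: eq_bigr => v _; case: (P v); case: (Q v).
Qed.

(* Slide a window of [m] terms with common difference [d]: each window lies
   inside C, outside C, or crosses the boundary of C. *)
Lemma window_bound (B C : pred nat) n d m k q : 0 < d -> 0 < m -> ap3_free B ->
  (forall v, B v -> C v) -> (forall v, C v -> v < n) ->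
  (forall B', ap3_free B' -> q * cnt B' 0 m <= k * m) ->
  q * cnt B 0 n <=
    k * cnt C 0 n + q * (2 * m * cnt (fun v => C v && ~~ shiftp C d v) 0 n).
Proof.
move=> d0 m0 fB BC Cn hm; set bd := cnt (fun v => _ && ~~ _) 0 n.
(* This range has room for every shift by [i * d] with [i <= m], so shifting loses no points. *)
pose V := n + m.+1 * d.
have winsum (P : pred nat) : (forall v, P v -> v < n) ->
    \sum_(0 <= v < V) \sum_(0 <= i < m) shiftp P (i * d) v = m * cnt P 0 n.
  move=> Pn; rewrite exchange_big /= (eq_big_nat _ _ (F2 := fun=> cnt P 0 n)).
    by rewrite sum_nat_const_nat subn0.
  by move=> i im; apply: cnt_shiftp => //; rewrite /V; nia.
(* [up] and [dn] record where a window leaves and enters [C]. All shifts of [C] have the same size,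
   so exits and entries are equally frequent. *)
pose up i v := shiftp C (i * d) v && ~~ shiftp C (i.+1 * d) v.
pose dn i v := ~~ shiftp C (i * d) v && shiftp C (i.+1 * d) v.
have upE i : i < m -> cnt (up i) 0 V = bd.
  move=> im; rewrite /bd -(@cnt_shiftp _ n (i * d) V) ?/V; last by nia.
    apply: eq_bigr => v _; rewrite /up [i.+1 * d]mulSn shiftpD.
    rewrite /shiftp; case: leqP => //=.
  by move=> v /andP[/Cn].
have dnE i : i < m -> cnt (dn i) 0 V = bd.
  move=> im; rewrite -(upE i im).
  have h1 := cnt_split (shiftp C (i * d)) (shiftp C (i.+1 * d)) 0 V.
  have h2 := cnt_split (shiftp C (i.+1 * d)) (shiftp C (i * d)) 0 V.
  rewrite (cnt_shiftp Cn) in h1; last by rewrite /V; nia.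
  rewrite (cnt_shiftp Cn) in h2; last by rewrite /V; nia.
  have e1 : cnt (dn i) 0 V = cnt (fun v => shiftp C (i.+1 * d) v && ~~ shiftp C (i * d) v) 0 V.
    by apply: eq_bigr => v _; rewrite /dn andbC.
  have e2 : cnt (fun v => shiftp C (i.+1 * d) v && shiftp C (i * d) v) 0 V =
     cnt (fun v => shiftp C (i * d) v && shiftp C (i.+1 * d) v) 0 V.
    by apply: eq_bigr => v _; rewrite andbC.
  by rewrite e1; rewrite e2 in h2; rewrite /up; lia.
(* A window without crossing lies on one side of [C]: inside, the density hypothesis applies to the
   reflected set; outside, [B] has no points. A crossing window is charged its full length [m]. *)
have point v : q * \sum_(0 <= i < m) shiftp B (i * d) v <=
    k * \sum_(0 <= i < m) shiftp C (i * d) v +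
    q * m * \sum_(0 <= i < m) (up i v + dn i v).
  have bm : \sum_(0 <= i < m) shiftp B (i * d) v <= m.
    by have := cnt_le (fun i => shiftp B (i * d) v) 0 m; rewrite subn0.
  case: (posnP (\sum_(0 <= i < m) (up i v + dn i v))) => [z|s0]; last first.
    apply: leq_trans (leq_addl _ _); rewrite -mulnA leq_mul2l.
    by rewrite (leq_trans bm) ?orbT ?leq_pmulr.
  rewrite z muln0 addn0.
  have const i : i <= m -> shiftp C (i * d) v = shiftp C (0 * d) v.
    elim: i => // i IH im; rewrite -IH; last by lia.
    move/eqP: z; rewrite sum_nat_seq_eq0 => /allP/(_ i).
    rewrite mem_index_iota im => /(_ isT) /=; rewrite /up /dn.
    by case: (shiftp C (i * d) v); case: shiftp.
  case c0: (shiftp C (0 * d) v) const => const.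
    rewrite [X in _ <= k * X](eq_big_nat _ _ (F2 := fun=> 1)).
      rewrite sum_nat_const_nat subn0 muln1.
      exact: (hm (fun i => shiftp B (i * d) v) (ap3_free_reflect d0 fB)).
    by move=> i im; rewrite const //; lia.
  rewrite [X in q * X <= _]big_nat_cond big1 ?muln0 // => i; rewrite andbT => im.
  have := const i ltac:(lia); rewrite /shiftp; case: leqP => //= _.
  by case: (boolP (B _)) => // /BC ->.
have := @leq_sum _ (index_iota 0 V) predT _ _ (fun v _ => point v).
rewrite -big_distrr /= winsum; last by move=> v /BC /Cn.
rewrite big_split /= -!big_distrr /= winsum // exchange_big /=.
rewrite (eq_big_nat _ _ (F2 := fun=> 2 * bd)).
  by rewrite sum_nat_const_nat subn0; clear -m0; nia.
by move=> i im; rewrite big_split /= mul2n -addnn -{1}(upE i im) -(dnE i im).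
Qed.

(** Cut the interval into blocks of length [m]; an incomplete last block costs at most [q * m]. *)
Lemma interval_bound (B : pred nat) m k q a l : 0 < m -> ap3_free B ->
  (forall B', ap3_free B' -> q * cnt B' 0 m <= k * m) ->
  q * cnt B a (a + l) <= k * l + q * m.
Proof.
move=> m0 fB hm; elim/ltn_ind: l a => l IH a.
have [lm|ml] := ltnP l m.
  have := cnt_le B a (a + l); rewrite addKn => h.
  by apply: leq_trans (leq_addl _ _); rewrite leq_mul2l (leq_trans h) ?orbT // ltnW.
rewrite (@cnt_cat _ a (a + m)) ?leq_add2l ?leq_addr // mulnDr.
have := IH (l - m) ltac:(lia) (a + m); rewrite -addnA subnKC // => h1.
have := hm (fun i => B (a + i * 1)) (@ap3_free_affine B a 1 isT fB).
have <- : cnt B a (a + m) = cnt (fun i => B (a + i * 1)) 0 m.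
  rewrite -[in LHS](add0n a) [0 + a + m]addnAC cnt_shift.
  by apply: eq_bigr => i _; rewrite muln1 addnC.
by nia.
Qed.

(** These [v] would complete a progression from a point of [B] below [b] with middle term in [M]. If
    [M] lies in [B] at or beyond [b], a progression-free [B] avoids them. *)
Definition reflect_in (B : pred nat) (b : nat) (M : seq nat) (v : nat) : bool :=
  has (fun m => [&& v <= 2 * m, 2 * m - v < b & B (2 * m - v)]) M.

(** Moving a centre by [d] moves its reflection by [2 * d]. Since centres are at least [b], a point
    [v < 2 * d] would be reflected past [b], so the guard in [shiftp] loses nothing. *)
Lemma reflect_in_hcube_cons (B : pred nat) b x d ds v :
  {in hcube x ds, forall m, b <= m} ->
  reflect_in B b (hcube x (d :: ds)) v =
  reflect_in B b (hcube x ds) v || shiftp (reflect_in B b (hcube x ds)) (2 * d) v.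
Proof.
move=> bM; rewrite /reflect_in /= has_cat has_map; congr (_ || _).
rewrite /shiftp; case: (leqP (2 * d) v) => h /=.
  apply: eq_has => m /=; have -> : 2 * (m + d) - v = 2 * m - (v - 2 * d) by lia.
  by have -> : (v <= 2 * (m + d)) = (v - 2 * d <= 2 * m) by lia.
apply/negbTE/hasPn => m /bM bm /=; apply/negP => /and3P[_ + _]; lia.
Qed.

Lemma hcube_suffix x pre ds : {subset hcube x ds <= hcube x (pre ++ ds)}.
Proof.
by elim: pre => //= d pre IH m /IH h; rewrite mem_cat h.
Qed.

(** Pigeonhole by telescoping over the generators, added one at a time from the end of the list. *)
Lemma small_increment (F : seq nat -> nat) c n ds :
  (exists pre d suf, ds = pre ++ d :: suf /\ c * F (d :: suf) <= c * F suf + n)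
  \/ size ds * n.+1 <= c * F ds.
Proof.
elim: ds => [|d ds [[pre [d' [suf [-> h]]]]|IH]]; first by right.
  by left; exists (d :: pre), d', suf.
have [h|h] := leqP (c * F (d :: ds)) (c * F ds + n).
  by left; exists [::], d, ds.
by right => /=; lia.
Qed.

Lemma cnt_reflect_in (B : pred nat) b x M n : x \in M -> b <= x -> 2 * x < n ->
  cnt B 0 b <= cnt (reflect_in B b M) 0 n.
Proof.
(* Reflection in [x] carries [0, b) onto [c, b + c), which ends at [2 * x] and so stays below
   [n]. *)
move=> xM bx xn; pose c := 2 * x + 1 - b.
set N := reflect_in B b M.
have e0 : b + c = 2 * x + 1 by rewrite /c; lia.
have cn : b + c <= n by lia.
rewrite (@cnt_cat N 0 c n) //; last by lia.
rewrite (@cnt_cat N c (b + c) n) ?leq_addl //.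
rewrite addnA addnAC; apply: leq_trans (leq_addl _ _).
rewrite -[X in cnt _ X (b + c)]add0n cnt_shift {1}/cnt big_nat_rev /=.
rewrite /cnt big_nat_cond [leqRHS]big_nat_cond.
apply: leq_sum => i; rewrite andbT => /andP[_ ib].
case Bi: (B _) => //; rewrite lt0b; apply/hasP; exists x => //.
have e : 2 * x - (i + c) = 0 + b - i.+1 by rewrite /c; lia.
by rewrite e Bi /c; lia.
Qed.

(* Szemeredi's argument. Reflecting the left part of B in the points of a
   Hilbert cube inside B gives a set disjoint from B; one step of the cube hardly
   enlarges it, so the complement is close to a union of long progressions,
   on which B has density at most (k + 1) / q. *)
Lemma roth_increment k q m : 0 < m -> 10 < k -> 11 * q < k ^ 2 ->
  (forall B, ap3_free B -> q * cnt B 0 m <= k.+1 * m) ->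
  exists n0, forall n (B : pred nat), n0 <= n -> ap3_free B ->
    (forall v, B v -> v < n) -> q * cnt B 0 n < k * n.
Proof.
move=> m0 k10 kq hm.
case: (posnP q) => [->|q0].
  by exists 1 => n B n1 _ _; rewrite mul0n muln_gt0 n1 andbT; lia.
(* In dimension [4 * q * m] some generator adds at most [n / (4 * q * m)] reflected points, as there
   are at most [n] in all. The density [1 / q] is the one met in the middle window. *)
have [D [w0 hD]] := hcube_exists (4 * q * m) q0.
exists (10 * (w0 + 9 + 2 * (q * m) + 8 * (q * m * D))) => n B hn fB Bn.
rewrite ltnNge; apply/negP => dB.
pose w := n %/ 10.
have w1 : w0 + 9 + 2 * (q * m) + 8 * (q * m * D) <= w by rewrite /w leq_divRL // mulnC.
have nw : 10 * w <= n <= 10 * w + 9 by rewrite /w; clear; lia.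
have kw : 11 * w <= k * w by rewrite leq_mul2r k10 orbT.
have ib a l := @interval_bound B m k.+1 q a l m0 fB hm.
have c1 := ib 0 (3 * w); rewrite add0n in c1.
have [r2 en2] : exists r, n = 3 * w + r by exists (n - 3 * w); clear -nw; lia.
have [r3 en3] : exists r, n = 3 * w + w + r by exists (n - (3 * w + w)); clear -nw; lia.
have c2 := ib (3 * w) r2; rewrite -en2 in c2.
have c3 := ib (3 * w + w) r3; rewrite -en3 in c3.
have s1 := @cnt_cat B 0 (3 * w) n isT ltac:(lia).
have s2 := @cnt_cat B (3 * w) (3 * w + w) n ltac:(lia) ltac:(lia).
(* [c1] and [c3] bound [B] on both sides of [3w, 4w), so [dB] leaves at least [w / q] points in that
   window. *)
have [||x [ds [sds ads cds]]] := hD w (3 * w) B; first by lia.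
  rewrite s1 s2 in dB; move: dB c1 c3.
  set b1 := cnt B 0 _; set b2 := cnt B _ (_ + w); set b3 := cnt B _ n => dB c1 c3.
  by clear -dB c1 c3 nw kw w1 en3; rewrite en3 in dB nw; lia.
pose N ds := reflect_in B (3 * w) (hcube x ds).
have [[pre [d [suf [eds hd]]]]|] := small_increment (fun ds => cnt (N ds) 0 n) (4 * q * m) n ds;
  last first.
  rewrite sds; have := cnt_le (N ds) 0 n; rewrite subn0 => h.
  have : 0 < 4 * q * m by rewrite !muln_gt0 q0 m0.
  by move=> c0; rewrite leq_pmul2l // ltnNge h.
have cds' : {in hcube x suf, forall v, (3 * w <= v < 3 * w + w) && B v}.
  by move=> v hv; apply: cds; rewrite eds -cat_rcons; apply: hcube_suffix.
have /andP[d0 dD] : 0 < d <= D.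
  by move/allP: ads; apply; rewrite eds mem_cat inE eqxx orbT.
have xsuf : x \in hcube x suf.
  by have := @hcube_suffix x suf [::] x; rewrite cats0; apply; rewrite inE.
have /andP[/andP[x1 x2] _] := cds' _ xsuf.
have hN := @cnt_reflect_in B (3 * w) x (hcube x suf) n xsuf x1 ltac:(lia).
pose C v := (v < n) && ~~ N suf v.
have BC v : B v -> C v.
  move=> Bv; rewrite /C Bn //=; apply/hasPn => m' /cds' /andP[/andP[m1 m2] Bm].
  apply/negP => /and3P[v1 v2 Bz].
  apply: (fB (2 * m' - v) (m' - (2 * m' - v))) => //; first by lia.
    by rewrite subnKC //; lia.
  by rewrite (_ : _ + _ = v) //; lia.
pose s := cnt (fun v => shiftp (N suf) (2 * d) v && ~~ N suf v) 0 n.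
have hs : cnt (N (d :: suf)) 0 n = cnt (N suf) 0 n + s.
  rewrite /cnt /s /cnt -big_split; apply: eq_bigr => v _ /=.
  rewrite /N reflect_in_hcube_cons; last by move=> v' /cds'; lia.
  by case: reflect_in; case: shiftp.
(* Beyond [2 * d], a point counted on the left is not reflected while its translate back by [2 * d]
   is, so it is one of the [s] new points. *)
have hbd : cnt (fun v => C v && ~~ shiftp C (2 * d) v) 0 n <= 2 * d + s.
  have dn : 2 * d <= n.
    have : 1 * D <= q * m * D by rewrite leq_mul2r muln_gt0 q0 m0 orbT.
    by clear -dD w1 nw; lia.
  rewrite (@cnt_cat _ 0 (2 * d)) //; apply: leq_add.
    by have := cnt_le (fun v => C v && ~~ shiftp C (2 * d) v) 0 (2 * d); rewrite subn0.
  rewrite /s [leqRHS](@cnt_cat _ 0 (2 * d)) //; apply: leq_trans (leq_addl _ _).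
  apply: cnt_sub => v hv; rewrite /C /shiftp => /andP[/andP[_ ->]].
  have -> : v - 2 * d < n by lia.
  by case/andP: hv => -> _; rewrite negbK /= => ->.
have hC : cnt C 0 n + cnt (N suf) 0 n = n.
  rewrite /cnt -big_split /= (eq_big_nat _ _ (F2 := fun=> 1)).
    by rewrite sum_nat_const_nat subn0 muln1.
  by move=> v /andP[_ vn]; rewrite /C vn; case: (N suf v).
have hw := @window_bound B C n (2 * d) m k.+1 q ltac:(lia) m0 fB BC
  (fun v h => proj1 (andP h)) hm.
rewrite hs in hd.
move: hd hbd hw hC hN c1 c2 dB; rewrite s1 /N.
set bd := cnt (fun v => C v && _) _ _; set cC := cnt C _ _.
set cN := cnt (reflect_in _ _ _) _ _; set b1 := cnt B 0 _; set b2 := cnt B _ n.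
move=> hd hbd hw hC hN c1 c2 dB.
have hbd' : 2 * (q * m * bd) <= n.
  have : q * m * bd <= q * m * (2 * d + s) by rewrite leq_mul2l hbd orbT.
  have : q * m * d <= q * m * D by rewrite leq_mul2l dD orbT.
  by clear -hd w1 nw; lia.
(* By [window_bound], [C] must be nearly everything, so the reflection has at most [2 * n / k.+1]
   points. It also contains a mirror image of [B] below [3 * w], hence at least [2 * k * w / q]
   points. With [n <= 11 * w] this contradicts [11 * q < k ^ 2]. *)
have h1 : k.+1 * cN <= 2 * n.
  by clear -hC hw hbd' dB; rewrite -hC in dB hbd' *; lia.
have h2 : 2 * (k * w) <= q * cN.
  have : q * b1 <= q * cN by rewrite leq_mul2l hN orbT.
  by clear -dB c2 w1 nw kw en2; rewrite en2 in dB nw; lia.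
have h3 : 2 * (k * k * w) <= 2 * (11 * q * w).
  have : k.+1 * (2 * (k * w)) <= k.+1 * (q * cN) by rewrite leq_mul2l h2 orbT.
  have : q * (k.+1 * cN) <= q * (2 * n) by rewrite leq_mul2l h1 orbT.
  have : q * n <= q * (11 * w) by rewrite leq_mul2l; apply/orP; right; clear -w1 nw; lia.
  by clear; lia.
rewrite -mulnn in kq.
have : 11 * q * w < k * k * w by rewrite ltn_mul2r kq andbT; clear -w1; lia.
by clear -h3; lia.
Qed.

Lemma roth t : 0 < t -> exists n0, forall n (B : pred nat), n0 <= n ->
  ap3_free B -> t * cnt B 0 n < n.
Proof.
move=> t0; apply: contrapT => nroth.
(* Here [a / q] is [1 / t], while [a > 10] and [a ^ 2 > 11 * q], so [roth_increment] is available
   for every [k >= a]. *)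
pose a := 11 * t + 1; pose q := t * a.
(* The largest k with dense k gives the limsup density of ap3-free sets up to 1 / q *)
pose dense k := forall n0, exists n, exists B : pred nat,
  [/\ n0 <= n, ap3_free B, (forall v, B v -> v < n) & k * n <= q * cnt B 0 n].
have da : dense a.
  move=> n0; apply: contrapT => nd; apply: nroth; exists n0 => n B nn fB.
  rewrite ltnNge; apply/negP => h; apply: nd.
  exists n, (fun v => (v < n) && B v); split => //.
  - by apply: ap3_free_sub fB => v /andP[].
  - by move=> v /andP[].
  rewrite (_ : cnt _ 0 n = cnt B 0 n); first by rewrite /q; nia.
  by apply: eq_big_nat => v /andP[_ ->].
have [k [ak dk ndk]] : exists k, [/\ a <= k, dense k & ~ dense k.+1].
  have nd : ~ dense (a + q.+1).
    move=> /(_ 1)[n [B [n1 _ _]]]; have := cnt_le B 0 n; rewrite subn0; nia.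
  elim: q.+1 nd => [|j IH]; first by rewrite addn0.
  have [dj|/IH//] := pselect (dense (a + j)).
  by rewrite addnS => nd; exists (a + j); split => //; rewrite leq_addr.
have [n1 hn1] : exists n1, forall n (B : pred nat), n1 <= n -> ap3_free B ->
    (forall v, B v -> v < n) -> q * cnt B 0 n <= k.+1 * n.
  apply: contrapT => nh; apply: ndk => n1; apply: contrapT => nd.
  apply: nh; exists n1 => n B nn fB Bn; rewrite leqNgt; apply/negP => h.
  by apply: nd; exists n, B; split => //; rewrite ltnW.
pose m := maxn n1 1.
(* The bound [k.+1 / q] holds at the fixed length [m]; [roth_increment] improves it to below [k / q]
   at all large lengths, against [dk]. *)
have [||||n0 hn0] := @roth_increment k q m.
- by rewrite /m; lia.
- by move: ak; rewrite /a; lia.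
- by rewrite -mulnn; move: ak; rewrite /q /a => ak; nia.
- move=> B fB; rewrite (_ : cnt B 0 m = cnt (fun v => (v < m) && B v) 0 m).
    apply: hn1; rewrite ?leq_maxl //; last by move=> v /andP[].
    by apply: ap3_free_sub fB => v /andP[].
  by apply: eq_big_nat => v /andP[_ ->].
have [n [B [nn fB Bn h]]] := dk n0.
by have := hn0 n B nn fB Bn; rewrite ltnNge h.
Qed.

(** * Divisors and smooth numbers *)

(** The interval is open at [a] and closed at [b]: T_n(P) is [divc n 0 P] and D_n(P) is
    [divc n P (2 * P)]. *)
Definition divc (n a b : nat) : nat := cnt (fun e => e %| n) a.+1 b.+1.

Lemma divc_cat n a b c : (a <= b <= c) -> divc n a c = (divc n a b + divc n b c).
Proof. by move=> /andP[ab bc]; rewrite /divc -cnt_cat. Qed.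

Lemma divc_gt0 n x : (0 < x) -> (0 < divc n 0 x).
Proof.
by move=> x0; rewrite (@divc_cat n 0 1) // /divc /cnt big_nat1 dvd1n.
Qed.

Lemma divc_le n a b : (divc n a b <= b - a).
Proof. exact: cnt_le. Qed.

Lemma divc_mull m f a b : (divc m a b <= divc (m * f) a b).
Proof. by apply: cnt_sub => v _; apply: dvdn_mulr. Qed.

(** Write a divisor of [m * f] as [g * k] with [g] dividing [m] and [k] dividing [f]. Each [g]
    allows at most [2 * Q / g] values of [k], and each [k] divides at most [2 * g] of the [f]
    because [g * k > Q]; so [g] contributes at most [4 * Q]. *)
Lemma sum_divc_mul m Q : (0 < m) -> (0 < Q) ->
  (\sum_(Q.+1 <= f < (2 * Q).+1) divc (m * f) Q (2 * Q) <= 4 * Q * divc m 0 (2 * Q)).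
Proof.
move=> m0 Q0.
(* e %| m f is witnessed by g = gcd e m and k = e / g, for which k %| f *)
have wit e f : (Q < e <= 2 * Q) -> ((e %| m * f) <=
    \sum_(1 <= g < (2 * Q).+1) \sum_(1 <= k < (2 * Q).+1)
      (g %| m) * ((e == g * k) * (k %| f))).
  move=> he; case: (boolP (e %| m * f)) => // emf.
  pose g := gcdn e m; pose k := (e %/ g).
  have g0 : (0 < g) by rewrite gcdn_gt0 m0 orbT.
  have ge : (g %| e) := dvdn_gcdl _ _.
  have egk : e = (g * k) by rewrite mulnC divnK.
  have kf : (k %| f).
    have h : coprime k (m %/ g).
      by rewrite /coprime -(eqn_pmul2l g0) muln_gcdr -egk mulnC divnK ?dvdn_gcdr // muln1.
    by rewrite -(Gauss_dvdr f h) -(dvdn_pmul2l g0) -egk mulnA [(g * _)]mulnC divnK ?dvdn_gcdr.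
  have k0 : (0 < k) by move: he; rewrite egk; case: (k) => //; rewrite muln0.
  have gle : (g <= e) by rewrite egk leq_pmulr.
  have kle : (k <= e) by rewrite egk leq_pmull.
  rewrite (bigD1_seq g) ?iota_uniq ?mem_index_iota //=; last by rewrite g0; lia.
  rewrite (bigD1_seq k) ?iota_uniq ?mem_index_iota //=; last by rewrite k0; lia.
  by rewrite /g dvdn_gcdr -/g -egk eqxx kf.
rewrite (@leq_trans (\sum_(Q.+1 <= f < (2 * Q).+1) \sum_(Q.+1 <= e < (2 * Q).+1)
    \sum_(1 <= g < (2 * Q).+1) \sum_(1 <= k < (2 * Q).+1)
      (g %| m) * ((e == g * k) * (k %| f)))) //.
  apply: leq_sum => f _; rewrite /divc /cnt big_nat_cond [leqRHS]big_nat_cond.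
  by apply: leq_sum => e; rewrite andbT; apply: wit.
under eq_bigr do (rewrite exchange_big /=; under eq_bigr do rewrite exchange_big).
rewrite exchange_big /divc /cnt big_distrr /=.
rewrite big_nat_cond [leqRHS]big_nat_cond.
apply: leq_sum => g; rewrite andbT => /andP[g1 gQ].
rewrite exchange_big /=.
have [gm|] := boolP (g %| m); last first.
  by move=> _; rewrite muln0 big1 // => k _; rewrite big1 // => f _; rewrite big1.
rewrite muln1.
rewrite (@leq_trans (\sum_(1 <= k < (2 * Q).+1) (k <= (2 * Q) %/ g) * (2 * g))) //; last first.
  rewrite -big_distrl /= (_ : \sum_(_ <= i < _) _ = (2 * Q) %/ g); last first.
    rewrite (@big_cat_nat _ _ _ ((2 * Q) %/ g).+1) //=; last by rewrite ltnS leq_div.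
    rewrite (eq_big_nat _ _ (F2 := fun=> 1)); last by move=> i /andP[_]; rewrite ltnS => ->.
    rewrite sum_nat_const_nat muln1 subn1 big_nat_cond big1 ?addn0 //= => i.
    by rewrite andbT => /andP[+ _]; rewrite ltnNge => /negbTE ->.
  by have := leq_trunc_div (2 * Q) g; nia.
rewrite big_nat_cond [leqRHS]big_nat_cond.
apply: leq_sum => k; rewrite andbT => /andP[k1 kQ].
under eq_bigr do under eq_bigr do rewrite mul1n.
under eq_bigr do rewrite -big_distrl /=.
rewrite -big_distrr /=.
have [hgk|hgk] := boolP (Q < g * k <= 2 * Q); last first.
  rewrite big_nat_cond big1 // => e; rewrite andbT => he.
  by case: eqP => // E; move: hgk; rewrite -E -ltnS he.
have -> : (k <= (2 * Q) %/ g) by rewrite leq_divRL // mulnC; case/andP: hgk.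
rewrite mul1n -[leqRHS]mul1n; apply: leq_mul.
  rewrite (bigD1_seq (g * k)) ?iota_uniq ?mem_index_iota //= eqxx.
  by rewrite big1 // => e /negbTE ->.
rewrite (@leq_trans (\sum_(1 <= f < (2 * Q).+1) (k %| f))) //.
  by rewrite [leqRHS](@big_cat_nat _ _ _ Q.+1) //= ?leq_addl // ltnS leq_pmull.
by rewrite -divn_count_dvd -ltnS ltn_divLR //; case/andP: hgk => + _; clear -k1; lia.
Qed.

Definition smoothn (Y n : nat) : bool := (0 < n) && all (leq^~ Y) (primes n).

Lemma smoothnP Y n :
  reflect ((0 < n) /\ forall p, prime p -> (p %| n) -> (p <= Y)) (smoothn Y n).
Proof.
apply: (iffP andP) => -[n0 h]; split => //.
  by move=> p pp pn; apply: (allP h); rewrite mem_primes pp n0.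
by apply/allP => p; rewrite mem_primes => /and3P[pp _ pn]; apply: h.
Qed.

Lemma smoothn_gt0 Y n : smoothn Y n -> (0 < n).
Proof. by case/andP. Qed.

Lemma smoothn_mul Y m f : smoothn Y m -> (0 < f <= Y) -> smoothn Y (m * f).
Proof.
move=> /smoothnP[m0 hm] /andP[f0 fY]; apply/smoothnP; rewrite muln_gt0 m0; split => // p pp.
by rewrite Euclid_dvdM // => /orP[/(hm _ pp)//|/(dvdn_leq f0)/leq_trans]; apply.
Qed.

Lemma smoothn_mull Y m f : smoothn Y (m * f) -> smoothn Y m.
Proof.
move=> /smoothnP[]; rewrite muln_gt0 => /andP[m0 f0] h.
by apply/smoothnP; split => // p pp pm; apply: h => //; apply: dvdn_mulr.
Qed.

(** * Prime counting and the number of smooth numbers *)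

Definition primepi (z : nat) : nat := #|[set p : 'I_z.+1 | prime p]|.

Lemma size_primes_le_primepi n z : {in primes n, forall p, p <= z} ->
  size (primes n) <= primepi z.
Proof.
move=> h; rewrite /primepi cardE -(size_map val).
apply: uniq_leq_size (primes_uniq n) _ => p pn.
have pz : p < z.+1 by rewrite ltnS h.
apply/mapP; exists (Ordinal pz) => //.
by rewrite mem_enum inE /=; move: pn; rewrite mem_primes => /and3P[].
Qed.

Lemma central_bin_ge n : 2 ^ n <= 'C(2 * n, n).
Proof.
elim: n => // n IH.
have -> : 2 * n.+1 = (2 * n).+2 by lia.
rewrite !binS expnS; case: n IH => [|n] // IH.
by rewrite binS; lia.
Qed.

(** By Legendre's formula the exponent is the sum over [k] of [(2 * n) %/ p ^ k - 2 * (n %/ p ^ k)];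
    each term is at most 1 and vanishes once [p ^ k > 2 * n]. *)
Lemma expn_logn_central_bin p n : prime p -> 0 < n -> p ^ logn p 'C(2 * n, n) <= 2 * n.
Proof.
move=> pp n0; have p1 := prime_gt1 pp; pose l := trunc_log p (2 * n).
have n2 : 0 < 2 * n by rewrite muln_gt0.
have /andP[lle lgt] := trunc_log_bounds p1 n2; rewrite -/l in lle lgt.
rewrite (leq_trans _ lle) // leq_exp2l //.
have := logn_fact (2 * n) pp.
have -> : (2 * n)`! = 'C(2 * n, n) * (n`! * n`!).
  by rewrite -(@bin_fact (2 * n) n); [congr (_ * (_ * _`!)); lia|lia].
rewrite !lognM ?muln_gt0 ?fact_gt0 ?bin_gt0 //; try lia.
rewrite logn_fact // addnn -mul2n.
have ext : \sum_(1 <= k < (2 * n).+1) n %/ p ^ k = \sum_(1 <= k < n.+1) n %/ p ^ k.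
  rewrite (@big_cat_nat _ _ _ n.+1) //=; last by lia.
  rewrite [X in _ + X]big_nat_cond [X in _ + X]big1 ?addn0 // => k; rewrite andbT => /andP[nk _].
  by rewrite divn_small // (leq_trans nk) // ltnW // ltn_expl.
rewrite -ext => eqn.
have h : \sum_(1 <= k < (2 * n).+1) (2 * n) %/ p ^ k <=
    \sum_(1 <= k < (2 * n).+1) (2 * (n %/ p ^ k) + (k < l.+1)).
  apply: leq_sum => k _; have pk : 0 < p ^ k by rewrite expn_gt0 ltnW.
  have [kl|lk] := ltnP k l.+1.
    rewrite -ltnS ltn_divLR //.
    have := divn_eq n (p ^ k); have := ltn_pmod n pk.
    by set a := n %/ _; set b := n %% _; set c := p ^ k; nia.
  by rewrite divn_small // (leq_trans lgt) // leq_exp2l.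
have h2 : \sum_(1 <= k < (2 * n).+1) (k < l.+1) <= l.
  have := @cnt_le (fun k => 1 <= k < l.+1) 1 l.+1; rewrite subn1 /= => h2.
  have lN : l <= 2 * n by rewrite ltnW // (leq_trans _ lle) // ltn_expl.
  rewrite (@big_cat_nat _ _ _ l.+1) //= [X in _ + X]big_nat_cond [X in _ + X]big1 ?addn0.
    by rewrite (leq_trans _ h2) //; apply: cnt_sub => k ->.
  by move=> k; rewrite andbT => /andP[+ _]; rewrite leqNgt => /negbTE ->.
by rewrite big_split /= -big_distrr /= in h; lia.
Qed.

(* Chebyshev: 'C(2n, n) is a product of prime powers that are at most 2n *)
Lemma primepi_ge n : 0 < n -> 2 ^ n <= (2 * n) ^ primepi (2 * n).
Proof.
move=> n0; apply: leq_trans (central_bin_ge n) _; set c := 'C(2 * n, n).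
have c0 : 0 < c by rewrite bin_gt0; lia.
rewrite [leqLHS](prod_prime_decomp c0) prime_decompE big_map /=.
apply: leq_trans (_ : \prod_(p <- primes c) (2 * n) <= _).
  rewrite big_seq [leqRHS]big_seq; apply: leq_prod => p.
  by rewrite mem_primes => /and3P[pp _ _]; apply: expn_logn_central_bin.
rewrite big_const_seq count_predT iter_muln_1.
rewrite leq_pexp2l ?muln_gt0 //; apply: size_primes_le_primepi => p.
rewrite mem_primes => /and3P[pp _ pc].
rewrite (leq_trans _ (expn_logn_central_bin pp n0)) //.
by rewrite -{1}(expn1 p) leq_exp2l ?prime_gt1 // -pfactor_dvdn.
Qed.

Lemma cnt_card (P : pred nat) n : cnt P 0 n = #|[set i : 'I_n | P i]|.
Proof.
rewrite /cnt big_mkord -sum1_card [RHS]big_mkcond /=.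
by apply: eq_bigr => i _; rewrite inE; case: (P i).
Qed.

(** Products over sets of primes up to [z] are distinct by unique factorisation, and each is at most
    [z ^ z]. *)
Lemma cnt_smoothn_ge Y N z : 0 < z -> z <= Y -> z ^ z <= N ->
  2 ^ primepi z <= cnt (smoothn Y) 0 N.+1.
Proof.
move=> z0 zY zN; pose P := [set p : 'I_z.+1 | prime p].
rewrite /primepi -/P -card_powerset cnt_card.
pose f (X : {set 'I_z.+1}) := \prod_(p in X) (p : nat).
have fP (X : {set 'I_z.+1}) (p : 'I_z.+1) : X \subset P -> prime p -> (p %| f X) = (p \in X).
  move=> /subsetP XP pp; apply/idP/idP => [|pX]; last by rewrite /f (bigD1 p) //= dvdn_mulr.
  rewrite /f Euclid_dvd_prod // big_orE => /existsP[q /andP[qX]].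
  have pq : prime q by have := XP q qX; rewrite inE.
  by rewrite dvdn_prime2 // => /eqP/val_inj ->.
have Pprime (X : {set 'I_z.+1}) p : X \subset P -> p \in X -> prime p.
  by move=> /subsetP XP /XP; rewrite inE.
have fgt0 (X : {set 'I_z.+1}) : X \subset P -> 0 < f X.
  by move=> XP; rewrite /f prodn_cond_gt0 // => p /(Pprime _ _ XP)/prime_gt0.
have fN (X : {set 'I_z.+1}) : X \subset P -> f X < N.+1.
  move=> XP; rewrite ltnS (leq_trans _ zN) //.
  apply: leq_trans (_ : \prod_(p in X) z <= _).
    by apply: leq_prod => p _; rewrite -ltnS ltn_ord.
  rewrite prod_nat_const leq_pexp2l //.
  have cz : #|[set~ ord0 : 'I_z.+1]| = z by rewrite cardsC1 card_ord.
  apply: leq_trans (eq_leq cz).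
  apply: subset_leq_card; apply/subsetP => p /(Pprime _ _ XP) pp.
  by rewrite !inE; apply: contraTneq pp => ->.
have finj : {in powerset P &, injective (fun X => inord (f X) : 'I_N.+1)}.
  move=> X X'; rewrite !powersetE => XP XP' /(congr1 val) /=.
  rewrite !inordK ?fN // => eqf; apply/setP => p.
  have [pp|np] := boolP (prime p); first by rewrite -(fP _ _ XP pp) eqf fP.
  have nin (Z : {set 'I_z.+1}) : Z \subset P -> (p \in Z) = false.
    by move=> ZP; apply/negP => /(Pprime _ _ ZP); apply/negP.
  by rewrite !nin.
rewrite -(card_in_imset finj); apply: subset_leq_card.
apply/subsetP => n /imsetP[X]; rewrite powersetE => XP ->; rewrite inE inordK ?fN //.
apply/smoothnP; split; first exact: fgt0.
move=> q qp; rewrite /f Euclid_dvd_prod // big_orE => /existsP[p /andP[pX]].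
rewrite dvdn_prime2 ?(Pprime _ _ XP pX) // => /eqP ->.
by rewrite (leq_trans _ zY) // -ltnS ltn_ord.
Qed.

Lemma prod_nth_pad T (x0 : T) (d : seq T) s (F : T -> nat) : size d <= s -> F x0 = 1 ->
  \prod_(i < s) F (nth x0 d i) = \prod_(x <- d) F x.
Proof.
move=> ds F0; rewrite (big_nth x0) -(big_mkord predT (fun i => F (nth x0 d i))).
rewrite (@big_cat_nat _ _ _ (size d)) //= [X in _ * X]big_nat_cond [X in _ * X]big1 ?muln1 //.
by move=> i; rewrite andbT => /andP[di _]; rewrite nth_default.
Qed.

(* A smooth number with at most s prime factors is encoded by its list of
   prime powers, padded with 0 ^ 0 = 1. *)
Lemma cnt_few_primes Y N s : 0 < N ->
  cnt (fun n => smoothn Y n && (size (primes n) <= s)) 0 N.+1 <=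
  (Y.+1 * (trunc_log 2 N).+1) ^ s.
Proof.
move=> N0; set L := trunc_log 2 N; rewrite cnt_card.
pose g (c : {ffun 'I_s -> 'I_Y.+1 * 'I_L.+1}) : 'I_N.+1 :=
  inord (\prod_(i < s) ((c i).1 ^ (c i).2)).
have -> : (Y.+1 * L.+1) ^ s = #|{ffun 'I_s -> 'I_Y.+1 * 'I_L.+1}|.
  by rewrite card_ffun card_prod !card_ord.
rewrite -cardsT; apply: leq_trans (leq_imset_card g _).
apply: subset_leq_card; apply/subsetP => n; rewrite inE => /andP[/smoothnP[n0 hn] sn].
pose d := prime_decomp n.
have sd : size d <= s by rewrite /d prime_decompE size_map.
have dP q : q \in d -> q.1 <= Y /\ q.2 <= L.
  rewrite /d prime_decompE => /mapP[p + ->] /=.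
  rewrite mem_primes => /and3P[pp _ pn]; split; first exact: hn.
  apply: trunc_log_max => //; apply: leq_trans (_ : n <= N); last by rewrite -ltnS ltn_ord.
  apply: leq_trans (dvdn_leq n0 (pfactor_dvdnn p n)).
  by rewrite leq_exp2r ?prime_gt1 // -pfactor_dvdn.
apply/imsetP; exists [ffun i : 'I_s =>
   (inord (nth (0, 0) d i).1, inord (nth (0, 0) d i).2)]; first by rewrite inE.
apply: val_inj; rewrite /g /=.
have bound i : (nth (0, 0) d i).1 < Y.+1 /\ (nth (0, 0) d i).2 < L.+1.
  have [id|di] := ltnP i (size d); last by rewrite nth_default.
  by rewrite !ltnS; apply: dP; apply: mem_nth.
rewrite (eq_bigr (fun i : 'I_s => (nth (0, 0) d i).1 ^ (nth (0, 0) d i).2)); last first.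
  by move=> i _; rewrite ffunE /=; have [b1 b2] := bound i; rewrite !inordK.
rewrite (@prod_nth_pad _ (0, 0) d s (fun x => x.1 ^ x.2)) // -(prod_prime_decomp n0).
by rewrite inordK.
Qed.

Lemma divc_ge_primes Y n x : smoothn Y n -> Y <= x -> size (primes n) <= divc n 0 x.
Proof.
move=> /smoothnP[n0 hn] Yx.
have -> : divc n 0 x = size [seq e <- index_iota 1 x.+1 | e %| n].
  rewrite /divc /cnt size_filter -sum1_count [RHS]big_mkcond /=.
  by apply: eq_bigr => e _; case: (e %| n).
apply: uniq_leq_size (primes_uniq n) _ => p; rewrite mem_primes => /and3P[pp _ pn].
by rewrite mem_filter pn mem_index_iota prime_gt0 // ltnS (leq_trans _ Yx) // hn.
Qed.

(** Here [2 ^ e] is about the eighth root of log N. [cnt_few_primes] gives at most [2 ^ W]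
    exceptions, while products of primes up to [2 ^ (l %/ 2)], about the square root of log N,
    already give far more smooth numbers. *)
Lemma few_divisors_negligible t K N Y :
  let l := trunc_log 2 (trunc_log 2 N) in let e := l %/ 8 in
  0 < N -> 16 * (t + 9 * K + 10) <= 2 ^ e -> 2 ^ (l %/ 2) <= Y -> Y < 2 ^ (K * l.+1) ->
  t * cnt (fun n => smoothn Y n && (size (primes n) <= 2 ^ e)) 0 N.+1 <=
  cnt (smoothn Y) 0 N.+1.
Proof.
move=> l e N0 he lY YK; set L := trunc_log 2 N in l e he lY YK *.
have e0 : 0 < e by case: (e) he => // h; exfalso; clear -h; rewrite expn0 in h; lia.
have l8 : 8 * e <= l < 8 * e + 8 by rewrite /e; clear; lia.
have L0 : 0 < L.
  by case: (posnP L) (l8) => // L0; rewrite /l L0 trunc_log0; clear -e0; lia.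
have /andP[lL Ll] := trunc_log_bounds (isT : 1 < 2) L0; rewrite -/l in lL Ll.
have /andP[LN _] := trunc_log_bounds (isT : 1 < 2) N0; rewrite -/L in LN.
pose W := (K.+1 * l.+1) * 2 ^ e.
have upper : cnt (fun n => smoothn Y n && (size (primes n) <= 2 ^ e)) 0 N.+1 <= 2 ^ W.
  apply: leq_trans (cnt_few_primes Y (2 ^ e) N0) _; rewrite -/L /W expnM leq_exp2r ?expn_gt0 //.
  by rewrite (mulSn K) expnD mulnC leq_mul.
pose h := (l %/ 2).-1.
have hl : h.+1 = l %/ 2 by rewrite /h prednK // divn_gt0 //; clear -l8 e0; lia.
have zE : 2 * 2 ^ h = 2 ^ (l %/ 2) by rewrite -expnS hl.
have lower : 2 ^ primepi (2 ^ (l %/ 2)) <= cnt (smoothn Y) 0 N.+1.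
  apply: cnt_smoothn_ge => //; first by rewrite expn_gt0.
  apply: leq_trans LN; rewrite -expnM leq_exp2l // (leq_trans _ lL) //.
  apply: leq_trans (_ : 2 ^ (l %/ 2) * 2 ^ (l %/ 2) <= _).
    by rewrite leq_mul2r ltnW ?orbT // ltn_expl.
  by rewrite -expnD leq_exp2l //; clear; lia.
have cheb : 2 ^ h <= h.+1 * primepi (2 ^ (l %/ 2)).
  have := @primepi_ge (2 ^ h); rewrite expn_gt0 zE => /(_ isT).
  by rewrite -expnM leq_exp2l // hl.
apply: leq_trans lower; apply: leq_trans (_ : 2 ^ (t + W) <= _).
  by rewrite expnD leq_mul // ltnW // ltn_expl.
rewrite leq_exp2l // leqNgt; apply/negP => hpi.
have e1 : e < 2 ^ e by rewrite ltn_expl.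
set E := 2 ^ e in he e1 W upper hpi.
have h4 : h.+1 <= 4 * E by rewrite hl; clear -l8 e1; lia.
have W8 : t + W <= (t + 8 * K.+1) * (E * E).
  have l1 : l.+1 <= 8 * E by clear -l8 e1; lia.
  have : K.+1 * l.+1 * E <= K.+1 * (8 * E) * E by rewrite leq_mul2r leq_mul2l l1 !orbT.
  have : t * 1 <= t * (E * E) by rewrite leq_mul2l muln_gt0 ltn_neqAle; apply/orP; right; clear -e1; lia.
  by rewrite /W; clear; lia.
(* Twice [2 ^ h] is at least [E ^ 4], but a failure would make [2 ^ h] less than a constant times
   [E ^ 3]; [he] makes [E] too large for that. *)
have h3 : E * E * E * E <= 2 * 2 ^ h.
  by rewrite zE /E -!expnD leq_exp2l //; clear -l8; lia.
have : 2 ^ h < 4 * E * ((t + 8 * K.+1) * (E * E)).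
  apply: leq_ltn_trans cheb _; apply: leq_trans (_ : h.+1 * (t + W) <= _).
    by rewrite ltn_pmul2l.
  exact: leq_mul.
have : (8 * (t + 8 * K.+1)) * (E * E * E) <= E * (E * E * E).
  by rewrite leq_mul2r; apply/orP; right; clear -he; lia.
clear -h3; lia.
Qed.

(** * Averaging over factorisations *)

Local Open Scope ring_scope.

Lemma sum_multiples (V : nmodType) N f (H : nat -> V) : (0 < f)%N ->
  \sum_(0 <= n < N.+1 | (f %| n)%N) H n = \sum_(0 <= m < N.+1 | (m * f <= N)%N) H (m * f)%N.
Proof.
move=> f0; rewrite !big_mkord.
rewrite (reindex_onto (fun m : 'I_N.+1 => inord (m * f)) (fun n : 'I_N.+1 => inord (n %/ f))) /=; last first.
  move=> n fn; apply: val_inj => /=.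
  have h : (n %/ f < N.+1)%N by rewrite (leq_ltn_trans (leq_div _ _)).
  by rewrite (inordK h) divnK // inordK.
have leN (m : 'I_N.+1) : (m * f <= N)%N -> (inord (m * f) : 'I_N.+1) = (m * f)%N :> nat.
  by move=> h; rewrite inordK.
apply: eq_big => [m|m].
  apply/andP/idP => [[_ /eqP/(congr1 val)/=]|h].
    rewrite inordK => [<-|]; last by rewrite ltnS (leq_trans (leq_div _ _)) // -ltnS.
    by rewrite (leq_trans (leq_trunc_div _ _)) // -ltnS ltn_ord.
  rewrite leN // dvdn_mull //; split => //; apply/eqP/val_inj => /=.
  by rewrite mulnK // inordK.
move=> /andP[_ /eqP/(congr1 val)/=].
rewrite inordK => [h|]; last by rewrite ltnS (leq_trans (leq_div _ _)) // -ltnS.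
by rewrite leN // -h (leq_trans (leq_trunc_div _ _)) // -ltnS ltn_ord.
Qed.

Lemma sum_divisor_pairs (V : nmodType) N a b (H : nat -> nat -> V) : (0 < a)%N ->
  \sum_(0 <= n < N.+1) \sum_(a <= f < b | (f %| n)%N) H n f =
  \sum_(0 <= m < N.+1) \sum_(a <= f < b | (m * f <= N)%N) H (m * f)%N f.
Proof.
move=> a0; under eq_bigr do rewrite big_mkcond; rewrite exchange_big /=.
under [RHS]eq_bigr do rewrite big_mkcond; rewrite [RHS]exchange_big /=.
apply: eq_big_nat => f /andP[af _].
by rewrite -!big_mkcond /= sum_multiples // (leq_trans a0).
Qed.

Lemma natr_cnt (R : realFieldType) (P : pred nat) a b :
  (cnt P a b)%:R = \sum_(a <= v < b | P v) 1 :> R.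
Proof. by rewrite /cnt natr_sum [RHS]big_mkcond; apply: eq_bigr => v _; case: (P v). Qed.

(** Convexity of the inverse: by [sum_divc_mul] the mean of the [Q] divisor counts is at most [a].
    They are positive, since [f] itself is counted. *)
Lemma sum_inv_divc_mul (R : realFieldType) m Q : (0 < m)%N -> (0 < Q)%N ->
  Q%:R / (4 * (divc m 0 (2 * Q))%:R) <=
  \sum_(Q.+1 <= f < (2 * Q).+1) (divc (m * f) Q (2 * Q))%:R^-1 :> R.
Proof.
move=> m0 Q0; set a : R := 4 * (divc m 0 (2 * Q))%:R.
have a0 : 0 < a by rewrite mulr_gt0 // ltr0n divc_gt0 // muln_gt0.
(* the tangent to x |-> 1 / x at a *)
have tangent (x : R) : 0 < x -> 2 / a - x / a ^+ 2 <= x^-1.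
  move=> x0; rewrite -subr_ge0.
  have -> : x^-1 - (2 / a - x / a ^+ 2) = (a - x) ^+ 2 / (a ^+ 2 * x).
    by field; rewrite !gt_eqF.
  by rewrite divr_ge0 ?sqr_ge0 // mulr_ge0 ?sqr_ge0 // ltW.
apply: le_trans (_ : \sum_(Q.+1 <= f < (2 * Q).+1)
    (2 / a - (divc (m * f) Q (2 * Q))%:R / a ^+ 2) <= _); last first.
  apply: ler_sum_nat => f hf; apply: tangent; rewrite ltr0n.
  rewrite /divc /cnt (bigD1_seq f) ?iota_uniq ?mem_index_iota //=.
  by rewrite dvdn_mull.
rewrite sumrB sumr_const_nat -mulr_suml -natr_sum.
have h := sum_divc_mul m0 Q0.
have -> : ((2 * Q).+1 - Q.+1 = Q)%N by lia.
have h' : (\sum_(Q.+1 <= f < (2 * Q).+1) divc (m * f) Q (2 * Q))%:R / a ^+ 2 <= Q%:R / a :> R.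
  rewrite expr2 invfM mulrA ler_wpM2r ?invr_ge0 ?(ltW a0) // ler_pdivrMr //.
  by rewrite /a -!natrM ler_nat; lia.
by move: h'; rewrite -mulr_natl; lra.
Qed.

(** For each smooth [n] the weights [1 / D n] over its divisors in the block total at most 1.
    Regrouping by the cofactor [m] brings in [sum_inv_divc_mul]; [m * (2 * Q) <= N] ensures that the
    whole block of [f] is present. *)
Lemma sum_inv_divc (R : realFieldType) Y N Q : (0 < Q)%N -> (2 * Q <= Y)%N ->
  \sum_(0 <= m < N.+1 | smoothn Y m && (m * (2 * Q) <= N)%N)
     (2 * Q)%:R / (divc m 0 (2 * Q))%:R <= 8 * (cnt (smoothn Y) 0 N.+1)%:R :> R.
Proof.
move=> Q0 QY.
pose D n : R := (divc n Q (2 * Q))%:R.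
pose H (n f : nat) : R := if smoothn Y n then (D n)^-1 else 0.
have H0 n f : 0 <= H n f by rewrite /H; case: ifP; rewrite // invr_ge0 ler0n.
have : \sum_(0 <= n < N.+1) \sum_(Q.+1 <= f < (2 * Q).+1 | (f %| n)%N) H n f <=
    (cnt (smoothn Y) 0 N.+1)%:R.
  rewrite natr_cnt [leRHS]big_mkcond; apply: ler_sum => n _; rewrite /H.
  case: ifP => _; last by rewrite big1.
  rewrite -[X in \sum_(_ <= _ < _ | _) X]mul1r -mulr_suml -natr_cnt.
  rewrite -/(divc n Q (2 * Q)) -/(D n).
  (* When no divisor of [n] lies in the block, [D n] is 0 and the weights total 0 instead of 1. *)
  by have [->|nz] := eqVneq (D n) 0; rewrite ?mul0r ?divff.
rewrite sum_divisor_pairs // => h.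
apply: le_trans (_ : 8 * \sum_(0 <= m < N.+1) \sum_(Q.+1 <= f < (2 * Q).+1 |
   (m * f <= N)%N) H (m * f)%N f <= _); last by rewrite ler_wpM2l.
rewrite mulr_sumr big_mkcond; apply: ler_sum => m _.
case: ifP => [/andP[Sm mN]|_]; last by rewrite mulr_ge0 // sumr_ge0.
have := @sum_inv_divc_mul R m Q (smoothn_gt0 Sm) Q0.
set T : R := (divc m 0 (2 * Q))%:R.
have -> : \sum_(Q.+1 <= f < (2 * Q).+1 | (m * f <= N)%N) H (m * f)%N f =
  \sum_(Q.+1 <= f < (2 * Q).+1) (divc (m * f) Q (2 * Q))%:R^-1 :> R.
  rewrite big_mkcond; apply: eq_big_nat => f /andP[f1 f2].
  have -> : (m * f <= N)%N by rewrite (leq_trans _ mN) // leq_mul2l -ltnS f2 orbT.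
  rewrite /H smoothn_mul //.
  by apply/andP; split; lia.
have T0 : 0 < T by rewrite ltr0n divc_gt0 // muln_gt0.
have -> : Q%:R / (4 * T) = Q%:R / T / 4 by field; rewrite gt_eqF.
by rewrite natrM -mulrA; lra.
Qed.

Lemma sum_divc_ratio (R : realFieldType) Y N P t (A : pred nat) : (0 < P)%N ->
  (forall n, A n -> smoothn Y n) ->
  (forall m, (0 < m)%N -> (t * cnt (fun f => A (m * f)%N) P.+1 (2 * P).+1 <= 2 * P)%N) ->
  t%:R * \sum_(0 <= n < N.+1 | A n) (divc n P (2 * P))%:R / (divc n 0 P)%:R <=
  2 * \sum_(0 <= m < N.+1 | smoothn Y m && (m * P <= N)%N) P%:R / (divc m 0 P)%:R :> R.
Proof.
move=> P0 AS hA.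
pose H (n f : nat) : R := if A n then (divc n 0 P)%:R^-1 else 0.
have -> : \sum_(0 <= n < N.+1 | A n) (divc n P (2 * P))%:R / (divc n 0 P)%:R =
   \sum_(0 <= n < N.+1) \sum_(P.+1 <= f < (2 * P).+1 | (f %| n)%N) H n f.
  rewrite big_mkcond; apply: eq_bigr => n _; rewrite /H.
  case: ifP => _; last by rewrite big1.
  by rewrite -[X in _ = \sum_(_ <= _ < _ | _) X]mul1r -mulr_suml -natr_cnt.
rewrite sum_divisor_pairs // !mulr_sumr [leRHS]big_mkcond; apply: ler_sum => m _.
set T : R := (divc m 0 P)%:R.
have T0 : 0 < T by rewrite ltr0n divc_gt0.
case: ifP => [/andP[Sm mP]|nSm]; last first.
  rewrite big_nat_cond big1 ?mulr0 // => f /andP[/andP[Pf fP] mf]; rewrite /H.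
  case: ifP => // /AS Smf; move: nSm; rewrite (smoothn_mull Smf) /=.
  by rewrite (leq_trans _ mf) // leq_mul2l ltnW ?orbT.
(* Divisors of [m] divide [m * f], so the weight only grows when it is taken at [m]. *)
apply: le_trans (_ : t%:R * \sum_(P.+1 <= f < (2 * P).+1 | A (m * f)%N) T^-1 <= _).
  rewrite ler_wpM2l // big_mkcond [leRHS]big_mkcond; apply: ler_sum => f _.
  rewrite /H; case: (A _); case: ifP => // _; last by rewrite invr_ge0 ltW.
  rewrite lef_pV2 ?posrE // ?ltr0n ?divc_gt0 //.
  by rewrite ler_nat divc_mull.
rewrite -[X in \sum_(_ <= _ < _ | _) X]mul1r -mulr_suml -natr_cnt !mulrA.
rewrite ler_wpM2r ?invr_ge0 ?(ltW T0) // -!natrM ler_nat.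
exact: hA (smoothn_gt0 Sm).
Qed.

(** * Telescoping over dyadic scales *)

Definition growth (R : realType) (n j : nat) : R :=
  (divc n (2 ^ j) (2 * 2 ^ j))%:R / (divc n 0 (2 ^ j))%:R.

Lemma divc_le_expR (R : realType) n j0 i :
  (divc n 0 (2 ^ (j0 + i)))%:R <=
  (divc n 0 (2 ^ j0))%:R * expR (\sum_(j0 <= j < j0 + i) growth R n j).
Proof.
elim: i => [|i IH]; first by rewrite addn0 big_geq // expR0 mulr1.
rewrite addnS big_nat_recr ?leq_addr //= expRD mulrA.
set T := divc n 0 (2 ^ (j0 + i)) in IH *.
have T0 : 0 < T%:R :> R by rewrite ltr0n divc_gt0 // expn_gt0.
have -> : (divc n 0 (2 ^ (j0 + i).+1))%:R = T%:R * (1 + growth R n (j0 + i)).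
  rewrite (@divc_cat n 0 (2 ^ (j0 + i))); last by rewrite leq0n leq_exp2l ?leqnSn.
  by rewrite natrD /growth expnS; field; rewrite gt_eqF.
by apply: ler_pM; rewrite ?ler0n ?expR_ge1Dx // addr_ge0 // divr_ge0.
Qed.

Lemma expR_half_le2 (R : realType) : expR (2^-1 : R) <= 2.
Proof.
have := @expR_ge1Dx R (- 2^-1); rewrite expRN.
have -> : 1 - 2^-1 = 2^-1 :> R by lra.
by rewrite lef_pV2 ?posrE ?expR_gt0.
Qed.

(** The divisor count starts at no more than [2 ^ j0] and reaches [2 ^ e], so the exponential of the
    sum is at least [2 ^ (e - j0)]; the half comes from [expR_half_le2]. *)
Lemma sum_growth_ge (R : realType) n j0 i e : (j0 <= e)%N ->
  (2 ^ e <= divc n 0 (2 ^ (j0 + i)))%N ->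
  (e - j0)%:R / 2 <= \sum_(j0 <= j < j0 + i) growth R n j.
Proof.
move=> je he; rewrite -ler_expR; set s := \sum_(_ <= _ < _) _.
have h1 : (2 ^ e)%:R <= (2 ^ j0)%:R * expR s :> R.
  apply: le_trans (_ : (divc n 0 (2 ^ (j0 + i)))%:R <= _); first by rewrite ler_nat.
  apply: le_trans (divc_le_expR R n j0 i) _.
  by rewrite ler_wpM2r ?expR_ge0 // ler_nat (leq_trans (divc_le _ _ _)) ?subn0.
have h2 : (2 ^ (e - j0))%:R <= expR s :> R.
  by move: h1; rewrite -{1}(subnKC je) expnD natrM ler_pM2l // ltr0n expn_gt0.
apply: le_trans h2; rewrite expRM_natl natrX.
by rewrite lerXn2r ?nnegrE ?expR_ge0 // expR_half_le2.
Qed.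

Lemma ap3_free_smooth_bound (R : realType) Y N J e j0 t (A : pred nat) :
  ap3_free A -> (forall n, A n -> smoothn Y n) ->
  (0 < j0 <= e)%N -> (j0 <= J)%N -> (2 ^ J <= Y)%N ->
  (forall n (B : pred nat), (2 ^ j0 <= n)%N -> ap3_free B -> (t * cnt B 0 n < n)%N) ->
  (t * ((e - j0) * cnt (fun n => A n && (2 ^ e <= divc n 0 (2 ^ J.+1))) 0 N.+1) <=
   32 * (J.+1 * cnt (smoothn Y) 0 N.+1))%N.
Proof.
move=> fA AS /andP[j00 je] jJ JY hroth.
set good := fun n : nat => _ && _; set S := cnt (smoothn Y) 0 N.+1.
have scale j : (j0 <= j < J.+1)%N ->
    (* The 16 is the 2 of [sum_divc_ratio] times the 8 of [sum_inv_divc], used at [P / 2]; this is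
       why [j0] must be positive. *)
    t%:R * \sum_(0 <= n < N.+1 | A n) growth R n j <= 16 * S%:R.
  move=> /andP[j0j jJ1]; pose P := (2 ^ j)%N.
  have P0 : (0 < P)%N by rewrite expn_gt0.
  have eP : P = (2 * 2 ^ j.-1)%N by rewrite -expnS prednK // (leq_trans j00).
  have PY : (P <= Y)%N by rewrite (leq_trans _ JY) // leq_exp2l // -ltnS.
  (* The [f] with [m * f] in [A] form an affine preimage of a progression-free set. Roth's theorem
     is applied on [0, 2P + 1), and its strictness gives the bound [2 * P]. *)
  have hA m : (0 < m)%N -> (t * cnt (fun f => A (m * f)%N) P.+1 (2 * P).+1 <= 2 * P)%N.
    move=> m0; rewrite -ltnS.
    apply: leq_ltn_trans (hroth _ (fun f => A (0 + f * m)%N) _ (ap3_free_affine _ _)) => //.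
      rewrite leq_mul2l [leqRHS](@cnt_cat _ 0 P.+1) //; last by rewrite ltnS leq_pmull.
      by rewrite (leq_trans _ (leq_addl _ _)) ?orbT // cnt_sub // => v _; rewrite mulnC.
    by rewrite (leq_trans (leq_pexp2l _ j0j)) // ltnW // ltnS leq_pmull.
  apply: le_trans (@sum_divc_ratio R Y N P t A P0 AS hA) _.
  have := @sum_inv_divc R Y N (2 ^ j.-1) ltac:(by rewrite expn_gt0).
  by rewrite -eP => /(_ PY); rewrite -/S; lra.
have total : t%:R * \sum_(0 <= n < N.+1 | A n) \sum_(j0 <= j < J.+1) growth R n j <=
    (J.+1)%:R * (16 * S%:R).
  rewrite exchange_big /= mulr_sumr.
  apply: le_trans (ler_sum_nat scale) _.
  rewrite sumr_const_nat -[leLHS]mulr_natl ler_wpM2r ?mulr_ge0 // ler_nat; exact: leq_subr.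
have lower : (e - j0)%:R / 2 * (cnt good 0 N.+1)%:R <=
    \sum_(0 <= n < N.+1 | A n) \sum_(j0 <= j < J.+1) growth R n j.
  rewrite natr_cnt mulr_sumr big_mkcond [leRHS]big_mkcond; apply: ler_sum => n _.
  rewrite /good; case: (A n) => //=; case: ifP => h.
    have eJ : J.+1 = (j0 + (J.+1 - j0))%N by rewrite subnKC // (leq_trans jJ).
    by rewrite mulr1 {1}eJ sum_growth_ge // -eJ.
  by rewrite sumr_ge0 // => j _; rewrite /growth divr_ge0.
have := le_trans (ler_wpM2l (ler0n R t) lower) total.
rewrite -(ler_nat R) !natrM -/S => h; set c := (cnt good 0 N.+1)%:R in h *.
by move: h; set u := _%:R; set v := _%:R; set z := _%:R; set y := _%:R; lra.
Qed.

(** * Choice of parameters and conclusion *)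

Lemma ln_nat_bounds (R : realType) N : (0 < N)%N ->
  (trunc_log 2 N)%:R / 2 <= ln (N%:R : R) < (trunc_log 2 N).+1%:R.
Proof.
move=> N0; have /andP[h1 h2] := trunc_log_bounds (isT : (1 < 2)%N) N0.
set L := trunc_log 2 N in h1 h2 *.
have lnK' : expR (ln (N%:R : R)) = N%:R by rewrite lnK // posrE ltr0n.
apply/andP; split.
  rewrite -ler_expR lnK' expRM_natl.
  apply: le_trans (_ : 2 ^+ L <= _); last by rewrite -natrX ler_nat.
  by rewrite lerXn2r ?nnegrE ?expR_ge0 // expR_half_le2.
rewrite -ltr_expR lnK' -[X in expR X]mulr1 expRM_natl.
apply: lt_le_trans (_ : 2 ^+ L.+1 <= _); first by rewrite -natrX ltr_nat.
rewrite lerXn2r ?nnegrE ?expR_ge0 //.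
by have := @expR_ge1Dx R 1; rewrite -natr1.
Qed.

Lemma smoothE (R : realType) (y : R) n : 0 <= y -> smooth y n = smoothn (Num.truncn y) n.
Proof.
move=> y0; rewrite /smooth /smoothn; congr (_ && _).
by apply: eq_all => p /=; rewrite truncn_ge_nat.
Qed.

Lemma no_3AP_free (A : {fset nat}) : ~ has_3AP A -> ap3_free (fun n => n \in A).
Proof.
move=> nA a d d0 a0 a1 a2; apply: nA; exists (Posz a), (Posz d).
split; first by rewrite -lt0n in d0 *; case: d d0 {a1 a2}.
- by apply/imfsetP; exists a.
- by apply/imfsetP; exists (a + d)%N.
- by apply/imfsetP; exists (a + d + d)%N => //=; lia.
Qed.

Lemma ap3_free_smooth_sparse (R : realType) K t0 : (0 < K)%N -> (0 < t0)%N ->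
  exists N0 : nat, forall N Y (A : pred nat), (N0 <= N)%N ->
  let l := trunc_log 2 (trunc_log 2 N) in
  (2 ^ (l %/ 2) <= Y < 2 ^ (K * l.+1))%N ->
  (forall n, A n -> smoothn Y n) -> ap3_free A ->
  (t0 * cnt A 0 N.+1 < cnt (smoothn Y) 0 N.+1)%N.
Proof.
(* 2048 is 2 * 32 * 16 * 2, the constants of [h1], [hgood], [Je] and [Sg]; the successor makes the
   final comparison contradictory. *)
move=> K0 t00; pose t := (2048 * (t0 * K)).+1.
have [n0 hroth] := @roth t isT.
pose j0 := n0.+1; pose E0 := (2 * j0 + 16 * (2 * t0 + 9 * K + 10))%N.
exists (2 ^ (2 ^ (8 * E0)))%N => N Y A NN l /andP[lY Yl] AS fA.
have N0 : (0 < N)%N by rewrite (leq_trans _ NN) // expn_gt0.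
have lE : (8 * E0 <= l)%N by do 2 (apply: trunc_log_max => //).
pose e := (l %/ 8)%N.
have eE : (E0 <= e)%N by rewrite /e leq_divRL // mulnC.
have el : (l < 8 * e + 8)%N by rewrite /e; clear; lia.
have Y0 : (0 < Y)%N by rewrite (leq_trans _ lY) // expn_gt0.
pose J := trunc_log 2 Y.
have /andP[JY YJ] := trunc_log_bounds (isT : (1 < 2)%N) Y0; rewrite -/J in JY YJ.
have hJ : (J < K * l.+1)%N by rewrite -(@ltn_exp2l 2) // (leq_ltn_trans JY).
have lJ : (l %/ 2 <= J)%N by apply: trunc_log_max.
have jJ : (j0 <= J)%N by apply: leq_trans lJ; clear -lE; lia.
have E1 : (16 * (2 * t0 + 9 * K + 10) <= 2 ^ e)%N.
  have e2 : (e < 2 ^ e)%N by rewrite ltn_expl.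
  by clear -eE e2; lia.
have je : (2 * j0 <= e)%N by clear -eE; lia.
have hbad := @few_divisors_negligible (2 * t0) K N Y N0 E1 lY Yl.
rewrite -/l -/e in hbad; set bad := cnt _ _ _ in hbad.
have hroth' n (B : pred nat) : (2 ^ j0 <= n)%N -> ap3_free B -> (t * cnt B 0 n < n)%N.
  move=> jn; apply: hroth; apply: leq_trans jn.
  by rewrite ltnW // ltnW // ltn_expl.
have := @ap3_free_smooth_bound R Y N J e j0 t A fA AS ltac:(clear -je; lia) jJ JY hroth'.
set g := cnt _ 0 _; set S := cnt (smoothn Y) _ _ in hbad * => hgood.
(* Outside [bad], [n] has more than [2 ^ e] prime factors, all at most [Y < 2 ^ J.+1]; being
   divisors, they make [n] count in [g]. *)
have Agb : (cnt A 0 N.+1 <= g + bad)%N.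
  rewrite /g /bad /cnt -big_split; apply: leq_sum => n _ /=.
  case An : (A n) => //=; rewrite AS //=; case: (leqP _ (2 ^ e)%N) => [|h]; first by rewrite addn1.
  by rewrite (leq_trans (ltnW h)) // (@divc_ge_primes Y) // ?AS // ltnW.
have S0 : (0 < S)%N.
  rewrite /S /cnt (bigD1_seq 1%N) ?iota_uniq ?mem_index_iota //= ltnS.
rewrite ltnNge; apply/negP => SA.
have Sg : (S <= 2 * t0 * g)%N.
  have : (t0 * cnt A 0 N.+1 <= t0 * (g + bad))%N by rewrite leq_mul2l Agb orbT.
  by clear -hbad SA; lia.
have g0 : (0 < g)%N by clear -S0 Sg; case: (g) Sg => //; rewrite muln0; lia.
have Je : (J.+1 <= 16 * (K * e))%N.
  have : (K * l.+1 <= K * (16 * e))%N.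
    by rewrite leq_mul2l; apply/orP; right; clear -el je; lia.
  by clear -hJ; lia.
have h1 : (t * e * g <= 2 * (t * ((e - j0) * g)))%N.
  have : (t * g * e <= t * g * (2 * (e - j0)))%N.
    by rewrite leq_mul2l; apply/orP; right; clear -je; lia.
  by clear; set d := (e - j0)%N; lia.
have h2 : (J.+1 * S <= 16 * (K * e) * (2 * t0 * g))%N by apply: leq_mul.
have : (t * (e * g) <= 2048 * (t0 * K) * (e * g))%N by clear -h1 h2 hgood; lia.
by rewrite leq_mul2r ltnn muln_eq0; clear -g0 je; lia.
Qed.

Theorem theorem1p1 (R : realType) :
  exists K0 : nat, forall K : nat, (0 < K)%N -> (K0 <= K)%N ->
  forall delta : R, 0 < delta ->
  exists N0 : nat, forall N : nat, (N0 <= N)%N ->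
  let y : R := ln (N%:R : R) ^+ K in
  forall A : {fset nat},
    (A `<=` smooth_set N y)%fset ->
    delta * (Psi N y)%:R <= (#|` A|%fset)%:R ->
    has_3AP A.
Proof.
exists 0%N => K K0 _ delta delta0.
(* A set of density [delta] violates the sparsity bound once [t0 * delta >= 1]. *)
pose t0 := (Num.truncn delta^-1).+1.
have ht0 : 1 <= delta * t0%:R.
  by rewrite -ler_pdivrMl // mulr1 ltW // truncnS_gt.
have [N0 sparse] := @ap3_free_smooth_sparse R K t0 K0 isT.
exists (maxn N0 (2 ^ 2 ^ (8 * K))) => N NN y A AS hA; apply: contrapT => /no_3AP_free fA.
have N1 : (2 ^ 2 ^ (8 * K) <= N)%N by apply: leq_trans NN; rewrite leq_maxr.
have Ngt0 : (0 < N)%N by rewrite (leq_trans _ N1) // expn_gt0.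
pose L := trunc_log 2 N; pose l := trunc_log 2 L.
have l8 : (8 <= l)%N.
  have : (8 * K <= l)%N by do 2 (apply: trunc_log_max => //).
  by clear -K0; lia.
have L0 : (0 < L)%N by case: (posnP L) l8 => // L0; rewrite /l L0 trunc_log0.
have /andP[lL Ll] := trunc_log_bounds (isT : (1 < 2)%N) L0; rewrite -/l in lL Ll.
have /andP[ln1 ln2] := ln_nat_bounds R Ngt0; rewrite -/L in ln1 ln2.
(* Since [l >= 8], [l %/ 2 + 1 <= l], so [2 ^ (l %/ 2)] is at most [L / 2], the lower bound for the
   logarithm. *)
have lnl : (2 ^ (l %/ 2))%:R <= ln (N%:R : R).
  apply: le_trans ln1; rewrite ler_pdivlMr // -natrM ler_nat -expnSr.
  by apply: leq_trans lL; rewrite leq_exp2l //; clear -l8; lia.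
have ln_ge1 : 1 <= ln (N%:R : R).
  by apply: le_trans lnl; rewrite ler1n expn_gt0.
have y0 : 0 <= y by rewrite /y exprn_ge0 // (le_trans _ ln_ge1).
pose Y := Num.truncn y.
have lY : (2 ^ (l %/ 2) <= Y)%N.
  rewrite truncn_ge_nat //; apply: le_trans lnl _; rewrite /y.
  by rewrite -[leLHS]expr1 ler_weXn2l.
have Yl : (Y < 2 ^ (K * l.+1))%N.
  rewrite -(ltr_nat R); apply: le_lt_trans (_ : Y%:R <= y) _; first by rewrite truncn_le.
  rewrite mulnC expnM natrX /y ltrXn2r ?nnegrE ?(le_trans _ ln_ge1) // -?lt0n //.
  by apply: lt_le_trans ln2 _; rewrite ler_nat.
have ASn n : n \in A -> smoothn Y n /\ (n < N.+1)%N.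
  move=> /(fsubsetP AS); rewrite !inE /= => /andP[nN]; rewrite smoothE // => -> ; split => //.
  by move: nN; rewrite mem_iota add1n => /andP[].
have lYl : (2 ^ (l %/ 2) <= Y < 2 ^ (K * l.+1))%N by rewrite lY.
have := sparse N Y (fun n => n \in A) (leq_trans (leq_maxl _ _) NN) lYl
  (fun n h => proj1 (ASn n h)) fA.
rewrite ltnNge => /negP; apply.
have SPsi : (cnt (smoothn Y) 0 N.+1 <= Psi N y)%N.
  rewrite cnt_filter /Psi; apply: uniq_leq_size => [|n].
    by rewrite filter_uniq // iota_uniq.
  rewrite mem_filter mem_index_iota => /andP[Sn /andP[_ nN]].
  by rewrite !inE /= smoothE // Sn mem_iota add1n nN (smoothn_gt0 Sn).
have AcA : (#|` A| <= cnt (fun n => n \in A) 0 N.+1)%N.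
  rewrite cnt_filter; apply: uniq_leq_size (fset_uniq A) _ => n nA.
  by rewrite mem_filter nA mem_index_iota (ASn _ nA).2.
rewrite -(ler_nat R) natrM.
apply: le_trans (_ : (Psi N y)%:R <= _); first by rewrite ler_nat.
apply: le_trans (_ : t0%:R * (#|` A|)%:R <= _); last by rewrite ler_wpM2l // ler_nat.
apply: le_trans (ler_wpM2l (ler0n _ t0) hA); rewrite mulrA [_ * delta]mulrC.
by rewrite ler_peMl.
Qed.
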